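(* Let $\hat\rho_\theta$, $\theta\in\mathbb{R}^{N_\theta}$, be a parameterized (full-rank) density operator, let $f,\tilde f:\mathbb{R}_{\ge 0}\to\mathbb{R}_{\ge 0}$ be Petz functions, and let $g_{\hat\rho_\theta,f}(\cdot,\cdot)$ and $g_{\hat\rho_\theta,\tilde f}(\cdot,\cdot)$ be the quantum Fisher metrics at $\hat\rho_\theta$ associated with $f$ and $\tilde f$, respectively. Then $$f\preceq\tilde f\quad\Longleftrightarrow\quad g_{\hat\rho_\theta,f}(\cdot,\cdot)\succeq g_{\hat\rho_\theta,\tilde f}(\cdot,\cdot),$$ where $f\preceq\tilde f$ means $f(t)\le\tilde f(t)$ for all $t\in\mathbb{R}_{\ge 0}$, and, for metrics $g,\tilde g$, $g\succeq\tilde g$ means $g(X,X)\ge\tilde g(X,X)$ for all tangent vectors $X$.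
   Context: The density operator is written as $\hat\rho_\theta=\sum_{i=1}^N p_i|\psi_i\rangle\langle\psi_i|$ with $\langle\psi_i|\psi_j\rangle=\delta_{i,j}$, $\mathrm{Tr}[\hat\rho_\theta]=1$ and $p_i>0$ (full rank); both the $p_i$ and the $|\psi_i\rangle$ may depend on the parameter $\theta\in\mathbb{R}^{N_\theta}$. A Petz function is a function $f:\mathbb{R}_{\ge 0}\to\mathbb{R}_{\ge 0}$ satisfying $f(1)=1$ and $f(t)=t\,f(t^{-1})$. A tangent vector is $X=\sum_{i=1}^{N_\theta}X^i\partial_i$ with $\partial_i=\partial/\partial\theta^i$. Its m-representation is $\hat X^{\mathrm m}_{\hat\rho_\theta}:=X\hat\rho_\theta$ (the derivative of $\hat\rho_\theta$ along $X$), and its e-representation with respect to $f$ is the operator $\hat X^{\mathrm e}_{\hat\rho_\theta,f}$ with matrix elements $$\langle\psi_i|\hat X^{\mathrm e}_{\hat\rho_\theta,f}|\psi_j\rangle=\frac{\langle\psi_i|\hat X^{\mathrm m}_{\hat\rho_\theta}|\psi_j\rangle}{p_j f(p_i/p_j)}.$$ The quantum Fisher metric associated with $f$ is $$g_{\hat\rho_\theta,f}(X,Y):=\mathrm{Tr}\big[\hat X^{\mathrm m}_{\hat\rho_\theta}\hat Y^{\mathrm e}_{\hat\rho_\theta,f}\big]=\sum_{i,j=1}^N\frac{1}{p_j f(p_i/p_j)}\langle\psi_j|\hat X^{\mathrm m}_{\hat\rho_\theta}|\psi_i\rangle\langle\psi_i|\hat Y^{\mathrm m}_{\hat\rho_\theta}|\psi_j\rangle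 .$$
   Formalization: The metric inequality is required for all parameterized density operators and all θ, not one fixed ρ_θ; the equivalence assumes N ≥ 2 and N_θ ≥ 1; f(t)=t f(1/t) at t=0 is read as a limit as t→0+; f and f̃ are nonzero for t>0. *)

(* Defs.v *)
From HB Require Import structures.
From mathcomp Require Import all_boot all_order all_algebra.
From mathcomp Require Import all_classical all_reals all_analysis.
From mathcomp Require Import complex.

Set Implicit Arguments.
Unset Strict Implicit.
Unset Printing Implicit Defensive.

Import Order.TTheory GRing.Theory Num.Theory.
Import numFieldNormedType.Exports.

Local Open Scope classical_set_scope.
Local Open Scope ring_scope.
Local Open Scope complex_scope.

(* A function on the nonnegative reals is a function [R -> R] of which only the
   values on [t >= 0] are ever used. *)
Record petz (R : realType) (f : R -> R) : Prop := Petz {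
  petz_ge0 : forall t, 0 <= t -> 0 <= f t;
  petz_1 : f 1 = 1;
  petz_inv : forall t, 0 < t -> f t = t * f t^-1;
  (* The equation [f t = t * f t^-1] at [t = 0], where its right-hand side only
     makes sense as a limit. (Using the library convention [0^-1 = 0] instead
     would force [f 0 = 0] and rule out [f t = (1 + t) / 2].) *)
  petz_inv0 : t * f t^-1 @[t --> 0^'+] --> f 0
}.

Definition petz_le (R : realType) (f f' : R -> R) : Prop :=
  forall t, 0 <= t -> f t <= f' t.

Definition adjmx (R : rcfType) (m n : nat) (A : 'M[R[i]]_(m, n)) :
  'M[R[i]]_(n, m) := (map_mx (@conjc R) A)^T.

Definition ketbra (R : rcfType) (N : nat) (u v : 'cV[R[i]]_N) : 'M[R[i]]_N :=
  u *m adjmx v.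

Definition braket (R : rcfType) (N : nat) (u : 'cV[R[i]]_N) (A : 'M[R[i]]_N)
    (v : 'cV[R[i]]_N) : R[i] :=
  (adjmx u *m A *m v) 0 0.

Definition spectral_mx (R : rcfType) (N : nat) (p : 'I_N -> R)
    (psi : 'I_N -> 'cV[R[i]]_N) : 'M[R[i]]_N :=
  \sum_i (p i)%:C *: ketbra (psi i) (psi i).

(* Only the density operator itself is required to be differentiable in the
   parameter: its spectral decomposition need not be chosen regularly.
   [R[i]] is not a normed module over [R], so regularity and derivatives are
   taken on the real and imaginary parts of the matrix entries. *)
Record param_density (R : realType) (N n : nat) := ParamDensity {
  weight : 'rV[R]_n -> 'I_N -> R;
  eigket : 'rV[R]_n -> 'I_N -> 'cV[R[i]]_N;
  weight_gt0 : forall theta i, 0 < weight theta i;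
  eigket_orthonormal : forall theta i j,
    braket (eigket theta i) 1%:M (eigket theta j) = (i == j)%:R;
  density_trace : forall theta,
    \tr (spectral_mx (weight theta) (eigket theta)) = 1;
  density_differentiable : forall theta a b,
    differentiable (fun th : 'rV[R]_n =>
      complex.Re (spectral_mx (weight th) (eigket th) a b) : R) theta /\
    differentiable (fun th : 'rV[R]_n =>
      complex.Im (spectral_mx (weight th) (eigket th) a b) : R) theta
}.

Definition density (R : realType) (N n : nat) (D : param_density R N n)
    (theta : 'rV[R]_n) : 'M[R[i]]_N :=
  spectral_mx (weight D theta) (eigket D theta).

Definition tangent_apply (R : realType) (n : nat) (X : 'rV[R]_n)
    (F : 'rV[R]_n -> R) (theta : 'rV[R]_n) : R :=
  \sum_(k < n) X 0 k * 'D_(delta_mx 0 k : 'rV[R]_n) F theta.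

Definition m_rep (R : realType) (N n : nat) (D : param_density R N n)
    (theta X : 'rV[R]_n) : 'M[R[i]]_N :=
  \matrix_(a, b)
    (tangent_apply X (fun th => complex.Re (density D th a b)) theta
     +i* tangent_apply X (fun th => complex.Im (density D th a b)) theta).

(* The operator is rebuilt from its matrix elements in the orthonormal basis
   [eigket D theta]; see [e_rep_elt]. *)
Definition e_rep (R : realType) (N n : nat) (f : R -> R)
    (D : param_density R N n) (theta X : 'rV[R]_n) : 'M[R[i]]_N :=
  let p := weight D theta in
  let psi := eigket D theta in
  \sum_i \sum_j
    (braket (psi i) (m_rep D theta X) (psi j) / (p j * f (p i / p j))%:C)
      *: ketbra (psi i) (psi j).

Definition fisher_metric (R : realType) (N n : nat) (f : R -> R)
    (D : param_density R N n) (theta X Y : 'rV[R]_n) : R[i] :=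
  \tr (m_rep D theta X *m e_rep f D theta Y).

(* In [R[i]], [x <= y] says that [y - x] is a nonnegative real number. *)
Definition metric_ge (R : realType) (n : nat)
    (g g' : 'rV[R]_n -> 'rV[R]_n -> R[i]) : Prop :=
  forall X, g' X X <= g X X.

Lemma braket_ketbra (R : rcfType) (N : nat) (u a b v : 'cV[R[i]]_N) :
  braket u (ketbra a b) v = braket u 1%:M a * braket b 1%:M v.
Proof.
rewrite /braket /ketbra !mulmx1 mulmxA -mulmxA.
by rewrite [in LHS]mxE big_ord1.
Qed.

Lemma braket_sum (R : rcfType) (N : nat) (I : finType) (u v : 'cV[R[i]]_N)
    (F : I -> 'M[R[i]]_N) :
  braket u (\sum_i F i) v = \sum_i braket u (F i) v.
Proof. by rewrite /braket mulmx_sumr mulmx_suml summxE. Qed.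

Lemma braketZ (R : rcfType) (N : nat) (u v : 'cV[R[i]]_N) c
    (A : 'M[R[i]]_N) : braket u (c *: A) v = c * braket u A v.
Proof. by rewrite /braket -scalemxAr -scalemxAl mxE. Qed.

Lemma e_rep_elt (R : realType) (N n : nat) (f : R -> R)
    (D : param_density R N n) (theta X : 'rV[R]_n) (i j : 'I_N) :
  braket (eigket D theta i) (e_rep f D theta X) (eigket D theta j) =
  braket (eigket D theta i) (m_rep D theta X) (eigket D theta j) /
    (weight D theta j * f (weight D theta i / weight D theta j))%:C.
Proof.
rewrite /e_rep braket_sum (bigD1 i) //= braket_sum (bigD1 j) //=.
rewrite braketZ braket_ketbra !eigket_orthonormal !eqxx !mulr1.
rewrite big1 ?addr0 => [|k kj]; last first.
  by rewrite braketZ braket_ketbra !eigket_orthonormal (negPf kj) !mulr0.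
rewrite big1 ?addr0 // => k ki; rewrite braket_sum big1 // => l _.
by rewrite braketZ braket_ketbra !eigket_orthonormal eq_sym (negPf ki) mul0r mulr0.
Qed.

Lemma fisher_metricE (R : realType) (N n : nat) (f : R -> R)
    (D : param_density R N n) (theta X Y : 'rV[R]_n) :
  let p := weight D theta in
  let psi := eigket D theta in
  fisher_metric f D theta X Y =
  \sum_i \sum_j ((p j * f (p i / p j))%:C)^-1
    * braket (psi j) (m_rep D theta X) (psi i)
    * braket (psi i) (m_rep D theta Y) (psi j).
Proof.
move=> p psi; rewrite /fisher_metric /e_rep mulmx_sumr raddf_sum.
apply: eq_bigr => i _; rewrite mulmx_sumr raddf_sum; apply: eq_bigr => j _ /=.
rewrite -scalemxAr mxtraceZ /ketbra mulmxA mxtrace_mulC mulmxA.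
rewrite /mxtrace big_ord1 -/(braket _ _ _).
by rewrite [_ / _]mulrC -!mulrA; congr (_ * _); rewrite mulrC.
Qed.

(* Main.v *)
(** In the eigenbasis of the state, with eigenvalues [p], the metric is
    [g(X, X) = \sum_(i, j) |X_ij|^2 / (p_j f(p_i / p_j))] because the
    m-representation [X] is Hermitian. It is thus a nonnegative combination of
    the values [1 / f(t)], so it decreases when [f] increases. Conversely, for
    [t > 0] with [t != 1], take weights with [p_0 / p_1 = t] and rotate the
    state in the plane of the first two eigenvectors: the derivative of the
    state is the commutator [J P - P J] of a rotation generator [J] with
    [P = diag p], and [g(X, X) = 2 (p_1 - p_0)^2 / (p_1 f(t))] determines
    [f(t)]. *)
Require Import Defs.
From HB Require Import structures.
From mathcomp Require Import all_boot all_order all_algebra.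
From mathcomp Require Import all_classical all_reals all_analysis.
From mathcomp Require Import complex.
From mathcomp Require Import ring.

Import Order.TTheory GRing.Theory Num.Theory.
Import numFieldNormedType.Exports.
Local Open Scope ring_scope.

Set Implicit Arguments.
Unset Strict Implicit.
Unset Printing Implicit Defensive.

Local Open Scope complex_scope.

(** * Hermiticity of the m-representation and the metric as a sum of squared moduli *)

Lemma adjmx_mul (R : rcfType) (m n p : nat) (A : 'M[R[i]]_(m, n))
    (B : 'M[R[i]]_(n, p)) : adjmx (A *m B) = adjmx B *m adjmx A.
Proof. by rewrite /adjmx map_mxM trmx_mul. Qed.

Lemma adjmxK (R : rcfType) (m n : nat) (A : 'M[R[i]]_(m, n)) :
  adjmx (adjmx A) = A.
Proof. by apply/matrixP => a b; rewrite !mxE conjcK. Qed.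

Lemma conjc_braket (R : rcfType) (N : nat) (u v : 'cV[R[i]]_N)
    (A : 'M[R[i]]_N) :
  conjc (braket u A v) = braket v (adjmx A) u.
Proof.
have -> (B : 'M[R[i]]_1) : conjc (B 0 0) = adjmx B 0 0 by rewrite !mxE.
by rewrite !adjmx_mul adjmxK mulmxA.
Qed.

Lemma spectral_mx_hermitian (R : rcfType) (N : nat) (p : 'I_N -> R)
    (psi : 'I_N -> 'cV[R[i]]_N) a b :
  spectral_mx p psi b a = conjc (spectral_mx p psi a b).
Proof.
rewrite /spectral_mx !summxE rmorph_sum; apply: eq_bigr => k _.
rewrite !mxE rmorphM /= oppr0; congr (_ * _).
by rewrite !big_ord1 !mxE rmorphM /= conjcK mulrC.
Qed.

(** Hermiticity of the state holds at every parameter, so it can be differentiated entrywise: real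
    parts are symmetric in [a], [b] and imaginary parts antisymmetric. *)
Lemma m_rep_hermitian (R : realType) (N n : nat) (D : param_density R N n)
    (theta X : 'rV[R]_n) :
  adjmx (m_rep D theta X) = m_rep D theta X.
Proof.
apply/matrixP => a b; rewrite !mxE /=; congr (_ +i* _).
  have -> : (fun th => complex.Re (density D th b a)) =
      (fun th => complex.Re (density D th a b)).
    apply/funext => th; rewrite /density spectral_mx_hermitian.
    by case: (spectral_mx _ _ _ _).
  by [].
have -> : (fun th => complex.Im (density D th b a)) =
    - (fun th => complex.Im (density D th a b)).
  apply/funext => th; rewrite fctE /density spectral_mx_hermitian.
  by case: (spectral_mx _ _ _ _).
rewrite /tangent_apply -sumrN; apply: eq_bigr => k _; rewrite -mulrN.
have [_ dIm] := density_differentiable D theta a b.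
by rewrite deriveN ?opprK//; exact: diff_derivable.
Qed.

(** By hermiticity the two matrix elements in each summand are conjugate; the metrics of two Petz
    functions can then be compared term by term. *)
Lemma fisher_metric_normE (R : realType) (N n : nat) (f : R -> R)
    (D : param_density R N n) (theta X : 'rV[R]_n) :
  let p := weight D theta in
  let z i j := braket (eigket D theta i) (m_rep D theta X) (eigket D theta j) in
  fisher_metric f D theta X X =
  \sum_i \sum_j ((p j * f (p i / p j))^-1)%:C * (z i j * conjc (z i j)).
Proof.
move=> p z; rewrite fisher_metricE; apply: eq_bigr => i _; apply: eq_bigr => j _.
by rewrite conjc_braket m_rep_hermitian -mulrA fmorphV [z i j * _]mulrC.
Qed.

(** * Order comparison of Petz functions and of their metrics *)

Lemma petz_gt0 (R : realType) (f : R -> R) : petz f ->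
  (forall t, 0 < t -> f t != 0) -> forall t, 0 < t -> 0 < f t.
Proof. by move=> fP f0 t t0; rewrite lt_def f0// (petz_ge0 fP)// ltW. Qed.

Lemma fisher_metric_antitone (R : realType) (f f' : R -> R) :
  (forall t, 0 < t -> 0 < f t) -> (forall t, 0 < t -> f t <= f' t) ->
  forall (N n : nat) (D : param_density R N n) (theta : 'rV[R]_n),
    metric_ge (fisher_metric f D theta) (fisher_metric f' D theta).
Proof.
move=> f0 ff' N n D theta X; rewrite !fisher_metric_normE.
apply: ler_sum => i _; apply: ler_sum => j _.
have pi0 := weight_gt0 D theta i; have pj0 := weight_gt0 D theta j.
have t0 : 0 < weight D theta i / weight D theta j by exact: divr_gt0.
apply: ler_wpM2r; first exact: mul_conjC_ge0.
have ft := f0 _ t0; have lft := ff' _ t0.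
by rewrite lecR lef_pV2 ?ler_pM2l// posrE mulr_gt0// (lt_le_trans ft).
Qed.

(* Positive arguments suffice: [petz_inv0] recovers the value at 0 as a limit. *)
Lemma petz_leP (R : realType) (f f' : R -> R) : petz f -> petz f' ->
  (forall t, 0 < t -> f t <= f' t) -> petz_le f f'.
Proof.
move=> fP f'P ff' t; rewrite le_eqVlt => /predU1P[<-|]; last exact: ff'.
apply: (ler_cvg_to (petz_inv0 fP) (petz_inv0 f'P)).
near=> s; have s0 : 0 < s by near: s; exact: nbhs_right_gt.
by rewrite ler_pM2l ?ff' ?invr_gt0.
Unshelve. all: by end_near. Qed.

(** * Rotations and their derivatives *)

(* Rodrigues' formula for [exp (x J)], valid when [J^3 = - J]. *)
Definition rotation (R : realType) (N : nat) (J : 'M[R]_N) (x : R) : 'M[R]_N :=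
  1%:M + sin x *: J + (1 - cos x) *: (J *m J).

Definition rotation_ket (R : realType) (N : nat) (J : 'M[R]_N) (x : R)
    (i : 'I_N) : 'cV[R[i]]_N :=
  map_mx (real_complex R) (col i (rotation J x)).

Lemma rotation0 (R : realType) (N : nat) (J : 'M[R]_N) : rotation J 0 = 1%:M.
Proof. by rewrite /rotation sin0 cos0 subrr !scale0r !addr0. Qed.

(** Transposition flips only the sine term, as [J] is skew and [J *m J] symmetric. Reducing powers
    by the cubic relation leaves [1 + (1 - cos^2 - sin^2) J^2]. *)
Lemma rotation_orthogonal (R : realType) (N : nat) (J : 'M[R]_N) (x : R) :
  J^T = - J -> J *m J *m J = - J ->
  (rotation J x)^T *m rotation J x = 1%:M.
Proof.
move=> JT J3; rewrite /rotation.
have -> : (1%:M + sin x *: J + (1 - cos x) *: (J *m J))^T =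
    1%:M - sin x *: J + (1 - cos x) *: (J *m J).
  have AT : (J *m J)^T = J *m J by rewrite trmx_mul JT mulNmx mulmxN opprK.
  apply/matrixP => a b; move/matrixP/(_ a b): AT; move/matrixP/(_ a b): JT.
  by move: (J *m J) => A; rewrite !mxE => -> ->; rewrite eq_sym mulrN.
rewrite !(mulmxDl, mulmxDr, mulNmx, mulmxN) !mul1mx !mulmx1.
rewrite -?scalemxAl -?scalemxAr.
rewrite !mulmxA !J3 mulNmx; apply/matrixP => a b; rewrite !mxE.
move: (\sum_j _) (_%:R) (J a b) => A d j.
transitivity (d + (1 - (cos x ^+ 2 + sin x ^+ 2)) * A); first by ring.
by rewrite cos2Dsin2 subrr mul0r addr0.
Qed.

Lemma rotation_ket_orthonormal (R : realType) (N : nat) (J : 'M[R]_N) (x : R)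
    (i j : 'I_N) : J^T = - J -> J *m J *m J = - J ->
  braket (rotation_ket J x i) 1%:M (rotation_ket J x j) = (i == j)%:R.
Proof.
move=> JT J3; rewrite /braket mulmx1.
have /matrixP/(_ i j) := rotation_orthogonal x JT J3; rewrite !mxE => E.
rewrite -[RHS](rmorph_nat (real_complex R)) -E rmorph_sum; apply: eq_bigr => k _.
by rewrite !mxE rmorphM /= oppr0.
Qed.

Lemma spectral_mx_trace (R : rcfType) (N : nat) (p : 'I_N -> R)
    (psi : 'I_N -> 'cV[R[i]]_N) :
  (forall i, braket (psi i) 1%:M (psi i) = 1) ->
  \tr (spectral_mx p psi) = (\sum_i p i)%:C.
Proof.
move=> psi1; rewrite /spectral_mx raddf_sum rmorph_sum; apply: eq_bigr => i _ /=.
rewrite mxtraceZ /ketbra mxtrace_mulC /mxtrace big_ord1.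
by have := psi1 i; rewrite /braket mulmx1 => ->; rewrite mulr1.
Qed.

(** The rotated eigenvectors are real, so the imaginary parts of the state vanish identically and
    only real functions remain to be differentiated. *)
Lemma rotation_spectral_mxE (R : realType) (N : nat) (p : 'I_N -> R)
    (J : 'M[R]_N) (x : R) a b :
  spectral_mx p (rotation_ket J x) a b =
  (\sum_i p i * (rotation J x a i * rotation J x b i))%:C.
Proof.
rewrite /spectral_mx summxE rmorph_sum; apply: eq_bigr => k _.
by rewrite mxE mxE big_ord1 2!mxE [in LHS]mxE [in LHS]mxE !mxE !rmorphM /= oppr0.
Qed.

Definition rotation_derivative (R : realType) (N : nat) (J : 'M[R]_N) (x : R) :
  'M[R]_N := cos x *: J + sin x *: (J *m J).

Lemma rotation_derivative0 (R : realType) (N : nat) (J : 'M[R]_N) :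
  rotation_derivative J 0 = J.
Proof. by rewrite /rotation_derivative sin0 cos0 scale0r addr0 scale1r. Qed.

Lemma is_derive_rotation (R : realType) (N : nat) (J : 'M[R]_N) (x : R) a b :
  is_derive x 1 (fun y => rotation J y a b)
    (rotation_derivative J x a b).
Proof.
have -> : (fun y => rotation J y a b) =
    (fun y => (1%:M : 'M[R]_N) a b + sin y * J a b + (1 - cos y) * (J *m J) a b).
  by apply/funext => y; rewrite /rotation !mxE.
apply: is_derive_eq.
by rewrite /rotation_derivative !mxE /GRing.scale /=; ring.
Qed.

Lemma is_derive_rotation_density (R : realType) (N : nat) (p : 'I_N -> R)
    (J : 'M[R]_N) (x : R) a b :
  is_derive x 1
    (fun y => \sum_i p i * (rotation J y a i * rotation J y b i))
    (\sum_i p i *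
     (rotation J x a i * rotation_derivative J x b i +
      rotation J x b i * rotation_derivative J x a i)).
Proof.
have -> : (fun y => \sum_i p i * (rotation J y a i * rotation J y b i)) =
    \sum_i (fun y => p i * (rotation J y a i * rotation J y b i)).
  by apply/funext => y; rewrite fct_sumE.
apply: is_derive_sum => i.
have da := is_derive_rotation J x a i; have db := is_derive_rotation J x b i.
exact: is_derive_eq.
Qed.

(** * The rotated family of states and its metric at the origin *)

Lemma derive_coord (R : realType) (n : nat) (k : 'I_n) (g : R -> R) :
  'D_(delta_mx 0 k) (fun th : 'rV[R]_n => g (th 0 k)) 0 = 'D_1 g 0.
Proof.
rewrite /derive; set F := (fun h => _); set G := (fun h : R => _).
suff -> : F = G by [].
by apply/funext => h; rewrite /F /G /= !mxE !eqxx.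
Qed.

Lemma tangent_apply_delta (R : realType) (n : nat) (k : 'I_n)
    (F : 'rV[R]_n -> R) (theta : 'rV[R]_n) :
  tangent_apply (delta_mx 0 k) F theta = 'D_(delta_mx 0 k) F theta.
Proof.
rewrite /tangent_apply (bigD1 k)//= mxE !eqxx mul1r big1 ?addr0// => l lk.
by rewrite mxE (negPf lk) andbF mul0r.
Qed.

Lemma rotation_density_differentiable (R : realType) (N n : nat)
    (p : 'I_N -> R) (J : 'M[R]_N) (k : 'I_n) (theta : 'rV[R]_n) a b :
  let rho (th : 'rV[R]_n) := spectral_mx p (rotation_ket J (th 0 k)) in
  differentiable (fun th => complex.Re (rho th a b) : R) theta /\
  differentiable (fun th => complex.Im (rho th a b) : R) theta.
Proof.
move=> rho; split.
  have -> : (fun th => complex.Re (rho th a b)) =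
      (fun y => \sum_i p i * (rotation J y a i * rotation J y b i))
        \o (fun th : 'rV[R]_n => th 0 k).
    by apply/funext => th; rewrite /rho rotation_spectral_mxE.
  apply: differentiable_comp; first exact: differentiable_coord.
  apply/derivable1_diffP.
  by have [] := is_derive_rotation_density p J (theta 0 k) a b.
have -> : (fun th => complex.Im (rho th a b)) = cst 0.
  by apply/funext => th; rewrite /rho rotation_spectral_mxE.
exact: differentiable_cst.
Qed.

(** The spectrum is constant and the eigenvectors turn with coordinate [k] alone. The definition is
    transparent so that its weights and eigenvectors compute. *)
Definition rotation_density (R : realType) (N n : nat) (k : 'I_n)
    (p : 'I_N -> R) (J : 'M[R]_N) (p_gt0 : forall i, 0 < p i)
    (p_sum : \sum_i p i = 1) (JT : J^T = - J) (J3 : J *m J *m J = - J) :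
  param_density R N n.
Proof.
refine (@ParamDensity R N n (fun=> p) (fun th => rotation_ket J (th 0 k))
  _ _ _ _).
- by [].
- by move=> th i j; exact: rotation_ket_orthonormal.
- move=> th; rewrite spectral_mx_trace ?p_sum// => i.
  by rewrite rotation_ket_orthonormal// eqxx.
- by move=> th a b; exact: rotation_density_differentiable.
Defined.

Lemma m_rep_rotation_density (R : realType) (N n : nat) (k : 'I_n)
    (p : 'I_N -> R) (J : 'M[R]_N) (p_gt0 : forall i, 0 < p i)
    (p_sum : \sum_i p i = 1) (JT : J^T = - J) (J3 : J *m J *m J = - J) a b :
  m_rep (rotation_density k p_gt0 p_sum JT J3) 0 (delta_mx 0 k) a b =
  (J a b * (p b - p a))%:C.
Proof.
rewrite mxE !tangent_apply_delta /density /=; congr (_ +i* _); last first.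
  rewrite (_ : (fun _ => _) = cst 0) ?derive_cst//.
  by apply/funext => th; rewrite rotation_spectral_mxE.
pose g y := \sum_i p i * (rotation J y a i * rotation J y b i).
rewrite (_ : (fun _ => _) = (fun th : 'rV[R]_n => g (th 0 k))).
  rewrite derive_coord.
  rewrite (@derive_val _ _ _ _ _ _ _ (is_derive_rotation_density p J 0 a b)).
  rewrite rotation0 rotation_derivative0.
  have Jba : J b a = - J a b by move/matrixP/(_ a b): JT; rewrite !mxE.
  (* With the identity as rotation, only [i = a] and [i = b] survive, giving
     [p a * J b a + p b * J a b]. *)
  under eq_bigr => i _ do
    rewrite !mxE mulrDr mulrCA [X in _ + X]mulrCA.
  rewrite big_split /= (bigD1 a)//= big1 ?addr0 => [|i ia]; last first.
    by rewrite eq_sym (negPf ia) mul0r.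
  rewrite (bigD1 b)//= big1 ?addr0 => [|i ib]; last first.
    by rewrite eq_sym (negPf ib) mul0r.
  by rewrite !eqxx !mul1r Jba; ring.
by apply/funext => th; rewrite rotation_spectral_mxE.
Qed.

Lemma rotation_ket0 (R : realType) (N : nat) (J : 'M[R]_N) (i : 'I_N) :
  rotation_ket J 0 i = delta_mx i 0.
Proof.
apply/matrixP => a b; rewrite /rotation_ket rotation0 !mxE (ord1 b) eqxx andbT.
exact: rmorph_nat (real_complex R) _.
Qed.

Lemma braket_delta (R : rcfType) (N : nat) (A : 'M[R[i]]_N) (i j : 'I_N) :
  braket (delta_mx i 0) A (delta_mx j 0) = A i j.
Proof.
rewrite /braket; have -> : adjmx (delta_mx i 0 : 'cV[R[i]]_N) = delta_mx 0 i.
  by rewrite /adjmx map_delta_mx trmx_delta.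
by rewrite -rowE -colE !mxE.
Qed.

(** At the origin the eigenvectors are the standard basis, so the brackets are the real entries of
    the commutator. *)
Lemma fisher_metric_rotation_density (R : realType) (f : R -> R) (N n : nat)
    (k : 'I_n) (p : 'I_N -> R) (J : 'M[R]_N) (p_gt0 : forall i, 0 < p i)
    (p_sum : \sum_i p i = 1) (JT : J^T = - J) (J3 : J *m J *m J = - J) :
  let D := rotation_density k p_gt0 p_sum JT J3 in
  fisher_metric f D 0 (delta_mx 0 k) (delta_mx 0 k) =
  (\sum_i \sum_j (p j * f (p i / p j))^-1 * (J i j * (p j - p i)) ^+ 2)%:C.
Proof.
move=> D; rewrite fisher_metric_normE rmorph_sum; apply: eq_bigr => i _.
rewrite rmorph_sum; apply: eq_bigr => j _; rewrite [RHS]rmorphM; congr (_ * _).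
rewrite /= mxE !rotation_ket0 braket_delta m_rep_rotation_density.
by rewrite conjc_real -rmorphM expr2.
Qed.

(** * Rotation in a coordinate plane and recovery of the Petz function *)

Lemma delta_skew_tr (R : pzRingType) (N : nat) (i0 i1 : 'I_N) :
  let J : 'M[R]_N := delta_mx i0 i1 - delta_mx i1 i0 in J^T = - J.
Proof. by move=> J; rewrite /J linearB /= !trmx_delta opprB. Qed.

(** [J *m J] is minus the projection onto the plane of [i0] and [i1], which fixes [J]. *)
Lemma delta_skew_cube (R : pzRingType) (N : nat) (i0 i1 : 'I_N) : i0 != i1 ->
  let J : 'M[R]_N := delta_mx i0 i1 - delta_mx i1 i0 in J *m J *m J = - J.
Proof.
move=> /negPf i01 J; have i10 : (i1 == i0) = false by rewrite eq_sym.
have JJ : J *m J = - (delta_mx i0 i0 + delta_mx i1 i1).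
  rewrite /J mulmxBl !mulmxBr !mul_delta_mx_cond i01 i10 !eqxx !mulr0n !mulr1n.
  by rewrite sub0r subr0 opprD.
rewrite JJ /J mulNmx mulmxDl !mulmxBr !mul_delta_mx_cond i01 i10 !eqxx.
by rewrite !mulr0n !mulr1n subr0 sub0r.
Qed.

Lemma fisher_metric_delta_skew (R : realType) (f : R -> R) (N n : nat)
    (k : 'I_n) (p : 'I_N -> R) (i0 i1 : 'I_N) (i01 : i0 != i1)
    (p_gt0 : forall i, 0 < p i) (p_sum : \sum_i p i = 1) :
  petz f ->
  let D := rotation_density k p_gt0 p_sum (delta_skew_tr R i0 i1)
    (delta_skew_cube R i01) in
  fisher_metric f D 0 (delta_mx 0 k) (delta_mx 0 k) =
  ((p i1 * f (p i0 / p i1))^-1 * (p i1 - p i0) ^+ 2 *+ 2)%:C.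
Proof.
move=> fP D; rewrite fisher_metric_rotation_density; congr (_%:C).
have i10 : i1 != i0 by rewrite eq_sym.
rewrite (bigD1 i0)//= (bigD1 i1)//= [X in _ + X + _]big1 => [|j /negPf j1].
  rewrite addr0 [X in _ + X](bigD1 i1)//= (bigD1 i0)//=.
  rewrite [X in _ + (_ + X + _)]big1 => [|j /negPf j0].
    rewrite [X in _ + (_ + X)]big1 => [|i /andP[/negPf i0' /negPf i1']].
      rewrite !addr0 !mxE !eqxx (negPf i01) (negPf i10) /= subr0 sub0r.
      rewrite mul1r mulN1r sqrrN -(sqrrN (p i0 - p i1)) opprB mulr2n.
      (* The Petz symmetry at [p i1 / p i0] makes the [(i1, i0)] term equal to the [(i0, i1)]
         term. *)
      congr (_ + _^-1 * _); rewrite (petz_inv fP) ?divr_gt0// invf_div.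
      by rewrite mulrA mulrCA mulfV ?mulr1// gt_eqF.
    by apply: big1 => j _; rewrite !mxE i0' i1' subr0 mul0r expr0n mulr0.
  by rewrite !mxE j0 eqxx (negPf i10) andbF subr0 mul0r expr0n mulr0.
by rewrite !mxE j1 eqxx (negPf i01) andbF subr0 mul0r expr0n mulr0.
Qed.

Lemma exists_weights (R : realType) (N : nat) (i0 i1 : 'I_N) (t : R) :
  i0 != i1 -> 0 < t ->
  exists p : 'I_N -> R,
    [/\ forall i, 0 < p i, \sum_i p i = 1 & p i0 / p i1 = t].
Proof.
(* Weights before normalization; dividing by their sum keeps the ratio [t]. *)
move=> i01 t0; pose w i := if i == i0 then t else 1.
have w0 i : 0 < w i by rewrite /w; case: eqP.
have S0 : 0 < \sum_i w i.
  by rewrite (bigD1 i0)//= ltr_pwDl// sumr_ge0// => i _; exact: ltW.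
exists (fun i => w i / \sum_i w i); split=> [i||].
- exact: divr_gt0.
- by rewrite -mulr_suml mulfV// gt_eqF.
- rewrite invf_div mulrA divfK ?gt_eqF// /w eqxx.
  by rewrite eq_sym (negPf i01) divr1.
Qed.

(** The family is chosen after [t], since one state tests only finitely many ratios of weights. *)
Lemma petz_le_of_metric_ge (R : realType) (f f' : R -> R) (N n : nat) :
  (1 < N)%N -> (0 < n)%N -> petz f -> petz f' ->
  (forall t, 0 < t -> 0 < f t) -> (forall t, 0 < t -> 0 < f' t) ->
  (forall (D : param_density R N n) (theta : 'rV[R]_n),
    metric_ge (fisher_metric f D theta) (fisher_metric f' D theta)) ->
  forall t, 0 < t -> f t <= f' t.
Proof.
move=> N1 n0 fP f'P f0 f'0 ge_ff' t t0.
(* At [t = 1] the two weights coincide and the rotation gives no information; normalization settles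
   this case. *)
have [->|t1] := eqVneq t 1; first by rewrite (petz_1 fP) (petz_1 f'P).
pose i0 : 'I_N := Ordinal (ltnW N1); pose i1 : 'I_N := Ordinal N1.
have i01 : i0 != i1 by [].
have [p [p0 p1 pt]] := exists_weights i01 t0.
pose k : 'I_n := Ordinal n0.
pose D := rotation_density k p0 p1 (delta_skew_tr R i0 i1)
  (delta_skew_cube R i01).
have := ge_ff' D 0 (delta_mx 0 k).
rewrite !fisher_metric_delta_skew// pt lecR ler_pMn2r// ler_pM2r.
  by rewrite lef_pV2 ?posrE ?mulr_gt0 ?f0 ?f'0// ler_pM2l.
(* The cancelled factor [(p i1 - p i0) ^+ 2] is positive, as equal weights would force [t = 1]. *)
rewrite exprn_even_gt0//= subr_eq0; apply: contra t1 => /eqP p10.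
by rewrite -pt p10 divff// gt_eqF.
Qed.

(* [f_neq0] and [f'_neq0] say that the quotients defining the two metrics are
   meaningful: the ratios of weights range over all positive reals. *)
Theorem theorem4 (R : realType) (f f' : R -> R)
    (f_petz : petz f) (f'_petz : petz f')
    (f_neq0 : forall t : R, 0 < t -> f t != 0)
    (f'_neq0 : forall t : R, 0 < t -> f' t != 0)
    (N n : nat) :
  (petz_le f f' ->
     forall (D : param_density R N n) (theta : 'rV[R]_n),
       metric_ge (fisher_metric f D theta) (fisher_metric f' D theta)) /\
  ((1 < N)%N -> (0 < n)%N ->
     (petz_le f f' <->
      forall (D : param_density R N n) (theta : 'rV[R]_n),
        metric_ge (fisher_metric f D theta) (fisher_metric f' D theta))).
Proof.
have f0 := petz_gt0 f_petz f_neq0; have f'0 := petz_gt0 f'_petz f'_neq0.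
have fwd : petz_le f f' -> forall (D : param_density R N n) (theta : 'rV[R]_n),
    metric_ge (fisher_metric f D theta) (fisher_metric f' D theta).
  move=> ff' D theta; apply: fisher_metric_antitone => // t t0.
  by apply: ff'; exact: ltW.
split=> // N1 n0; split=> // ge_ff'; apply: petz_leP => //.
exact: (petz_le_of_metric_ge N1 n0).
Qed.
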